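(* Let $M\in\mathrm{pSh}(\Omega,L)$. There is an ordinal $\alpha$ such that for all $n<\omega$ and all $\bar a,\bar b\in{}^n|M|$ with $E\bar a=E\bar b$: if $(M,\bar a)\sim^{E\bar a}_\alpha(M,\bar b)$, then $(M,\bar a)\sim^{E\bar a}_\beta(M,\bar b)$ for all ordinals $\beta$.
   Context: **Presheaves.** Fix a complete Heyting algebra $\Omega$ (top $\top$) and a cardinal $\mu$. A presheaf $M$ over $\Omega$ is a set $|M|$ of sections with maps $E:|M|\to\Omega$ (extent) and $\upharpoonright:|M|\times\Omega\to|M|$ (restriction) such that $a\upharpoonright Ea=a$, $E(a\upharpoonright p)=Ea\wedge p$, $(a\upharpoonright p)\upharpoonright q=a\upharpoonright(p\wedge q)$. Put $[a=b]_M=\bigvee\{p\le Ea\wedge Eb: a\upharpoonright p=b\upharpoonright p\}$; presheaves are extensional: $Ea=Eb=[a=b]_M$ implies $a=b$. For $p\in\Omega$, $|M\upharpoonright p|=\{a\in|M|:Ea\le p\}$. For a tuple $\bar a=\langle a_i:i<\gamma\rangle$ of sections, $E\bar a=\bigwedge_iEa_i$ ($E\emptyset=\top$), $\bar a\upharpoonright p=\langle a_i\upharpoonright p\rangle_i$, $[\bar a=\bar b]_M=\bigwedge_i[a_i=b_i]_M$. **Structures.** A signature has finitary relation symbols, finitary function symbols and a presheaf over $\Omega$ of constant symbols (so each constant $c$ has an extent $Ec$). An element $M$ of $\mathrm{pSh}(\Omega,L)$ is a presheaf with: for each $n$-ary $R$ a map $R^M:|M|^n\to\Omega$ with $R^M(\bar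 a)\le E\bar a$ and $[\bar a=\bar b]_M\wedge R^M(\bar a)\le R^M(\bar b)$; for each $n$-ary $f$ a map $f^M:|M|^n\to|M|$ with $Ef^M(\bar a)=E\bar a$ and $[\bar a=\bar b]_M\le[f^M(\bar a)=f^M(\bar b)]_M$; for each constant $c$ a section $\mathfrak c^M$ with $E\mathfrak c^M=Ec$, compatibly with restriction. **Partial isomorphisms.** For $A\subseteq|M|$, $\langle A\rangle=\{a\upharpoonright p:a\in A,p\in\Omega\}$. A partial isomorphism $h:M\to N$ is a bijection $h:A\to B$, $A\subseteq|M|$, $B\subseteq|N|$, with $[a_0=a_1]_M=[h(a_0)=h(a_1)]_N$ on $A$, such that, extending $h$ to $\langle A\rangle$ by $h(a\upharpoonright p)=h(a)\upharpoonright p$, for all $x,y,x_0,\dots\in\langle A\rangle$: $[x=y]_M=[h(x)=h(y)]_N$; $R^M(x_0,\dots,x_{n-1})=R^N(h(x_0),\dots,h(x_{n-1}))$; $[x=\mathfrak c^M]_M=[h(x)=\mathfrak c^N]_N$; $[f^M(x_0,\dots,x_{n-1})=x_n]_M=[f^N(h(x_0),\dots,h(x_{n-1}))=h(x_n)]_N$, for all relation symbols $R$, constants $c$ and function symbols $f$. Domains, ranges, values and inclusions below refer to the extended maps; $h_q$ is the restriction of $h$ to sections of extent exactly $q$. **$Q_\alpha(p)$.** $Q_0(p)$ is the class of all partial isomorphisms between elements of $\mathrm{pSh}(\Omega,L)$; $Q_\alpha(p)=\bigcap_{\beta<\alpha}Q_\beta(p)$ for limit $\alpha$; $h:M\to N$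 is in $Q_{\beta+1}(p)$ iff $h\in Q_\beta(p)$ and: (Forth) for every nonempty $\bar c=\langle c_i:i<\gamma\rangle$, $\gamma<\mu$, from $|M\upharpoonright p|$ there is a set $\{(h_j,q_j,\bar d_j):j\in J\}$ such that for each $j$: $h_j:M\to N$ is in $Q_\beta(q_j)$, $h_{q_j}\subseteq h_j$, $\bar d_j=\langle d_{ji}:i<\gamma\rangle$ is from $|N\upharpoonright E\bar c|$, $E\bar d_j=q_j$, $c_i\upharpoonright q_j\in\mathrm{dom}(h_j)$ and $h_j(c_i\upharpoonright q_j)=d_{ji}$ for all $i<\gamma$; and $\bigvee_jq_j=E\bar c$; (Back) for every nonempty $\bar d=\langle d_i:i<\gamma\rangle$, $\gamma<\mu$, from $|N\upharpoonright p|$ there is a set $\{(h_j,q_j,\bar c_j):j\in J\}$ such that for each $j$: $h_j\in Q_\beta(q_j)$, $h_{q_j}\subseteq h_j$, $\bar c_j=\langle c_{ji}\rangle$ is from $|M\upharpoonright E\bar d|$, $E\bar c_j=q_j$, $h_j(c_{ji})=d_i\upharpoonright q_j$ for all $i$; and $\bigvee_jq_j=E\bar d$. **$\sim$.** For tuples $\bar a$ from $|M\upharpoonright p|$ and $\bar b$ of the same length from $|N\upharpoonright p|$, $(M,\bar a)\sim^p_\alpha(N,\bar b)$ means that $h$ given by $h(a_i)=b_i$ is a (well-defined) partial isomorphism in $Q_\alpha(p)$. (With $p=E\bar a$ this presupposes that all entries of $\bar a$ have the same extent.) The least $\alpha$ as in the claim is called the Scott rank of $M$. *)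

(* Defs.v *)
From HB Require Import structures.
From mathcomp Require Import all_boot all_order.
From mathcomp Require Import boolp classical_sets.
From mathcomp Require wochoice.

Set Implicit Arguments.
Unset Strict Implicit.
Unset Printing Implicit Defensive.

Local Open Scope classical_set_scope.
Local Open Scope order_scope.

HB.mixin Record hasSupsAndImplication d (T : Type) of Order.TBLattice d T := {
  csup : set T -> T;
  csup_ub : forall (A : set T) x, A x -> x <= csup A;
  csup_le_ub : forall (A : set T) y, (forall x, A x -> x <= y) -> csup A <= y;
  himp : T -> T -> T;
  himpP : forall x y z : T, (z <= himp x y) = (Order.meet z x <= y)
}.

#[short(type="completeHeytingType")]
HB.structure Definition CompleteHeyting d :=
  {T of hasSupsAndImplication d T & Order.TBLattice d T}.

Definition cinf d (T : completeHeytingType d) (A : set T) : T :=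
  csup (lbound A).

(* Stated for raw extent and restriction maps because the extensionality axiom
   of presheaves refers to it. *)
Definition eq_value d (Omega : completeHeytingType d) (S : Type)
    (E : S -> Omega) (res : S -> Omega -> S) (a b : S) : Omega :=
  csup [set p | p <= Order.meet (E a) (E b) /\ res a p = res b p].

Record presheaf d (Omega : completeHeytingType d) := Presheaf {
  section :> Type;
  extent : section -> Omega;
  restr : section -> Omega -> section;
  restr_extent : forall a, restr a (extent a) = a;
  extent_restr : forall a p, extent (restr a p) = Order.meet (extent a) p;
  restr_restr : forall a p q, restr (restr a p) q = restr a (Order.meet p q);
  presheaf_extensional : forall a b, extent a = extent b ->
    extent b = eq_value extent restr a b -> a = b
}.

Section Tuples.
Context d (Omega : completeHeytingType d) (M : presheaf Omega).

Definition sec_eq (a b : M) : Omega := eq_value (@extent _ _ M) (@restr _ _ M) a b.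

(* Tuples of sections are families over an arbitrary index type, so that the
   n-tuples (index type 'I_n) and the tuples of infinite length are treated
   uniformly. *)
Definition tuple_extent (I : Type) (a : I -> M) : Omega :=
  cinf [set extent (a i) | i in [set: I]].

Definition tuple_eq (I : Type) (a b : I -> M) : Omega :=
  cinf [set sec_eq (a i) (b i) | i in [set: I]].

Definition tuple_below (I : Type) (p : Omega) (a : I -> M) : Prop :=
  forall i, extent (a i) <= p.

End Tuples.

Record signature d (Omega : completeHeytingType d) := Signature {
  rel_symbol : Type;
  rel_arity : rel_symbol -> nat;
  fun_symbol : Type;
  fun_arity : fun_symbol -> nat;
  const_symbol : presheaf Omega
}.

Record structure d (Omega : completeHeytingType d) (L : signature Omega) :=
  Structure {
  carrier :> presheaf Omega;
  rel_interp : forall r : rel_symbol L, ('I_(rel_arity r) -> carrier) -> Omega;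
  rel_interp_extent : forall r (a : 'I_(rel_arity r) -> carrier),
    rel_interp a <= tuple_extent a;
  rel_interp_eq : forall r (a b : 'I_(rel_arity r) -> carrier),
    Order.meet (tuple_eq a b) (rel_interp a) <= rel_interp b;
  fun_interp : forall f : fun_symbol L,
    ('I_(fun_arity f) -> carrier) -> carrier;
  fun_interp_extent : forall f (a : 'I_(fun_arity f) -> carrier),
    extent (fun_interp a) = tuple_extent a;
  fun_interp_eq : forall f (a b : 'I_(fun_arity f) -> carrier),
    tuple_eq a b <= sec_eq (fun_interp a) (fun_interp b);
  const_interp : const_symbol L -> carrier;
  const_interp_extent : forall c, extent (const_interp c) = extent c;
  const_interp_restr : forall c p,
    const_interp (restr c p) = restr (const_interp c) p
}.

Arguments rel_interp {d Omega L} s r a.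
Arguments fun_interp {d Omega L} s f a.
Arguments const_interp {d Omega L} s c.

(* The extension of the graph h to the closure of its domain under
   restriction. *)
Definition restr_closure d (Omega : completeHeytingType d)
    (M N : presheaf Omega) (h : M -> N -> Prop) (x : M) (y : N) : Prop :=
  exists a b p, [/\ h a b, x = restr a p & y = restr b p].

(* A partial isomorphism is given by its graph, whose two projections are the
   domain and the range.  [piso_eq] makes the extension to the closure under
   restriction single-valued. *)
Record partial_iso d (Omega : completeHeytingType d) (L : signature Omega)
    (M N : structure L) := PartialIso {
  graph : M -> N -> Prop;
  graph_functional : forall a b b', graph a b -> graph a b' -> b = b';
  graph_injective : forall a a' b, graph a b -> graph a' b -> a = a';
  piso_eq : forall a a' b b', graph a b -> graph a' b' ->
    sec_eq a a' = sec_eq b b';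
  piso_closure_eq : forall x x' y y',
    restr_closure graph x y -> restr_closure graph x' y' ->
    sec_eq x x' = sec_eq y y';
  piso_rel : forall (r : rel_symbol L)
      (x : 'I_(rel_arity r) -> M) (y : 'I_(rel_arity r) -> N),
    (forall i, restr_closure graph (x i) (y i)) ->
    rel_interp M r x = rel_interp N r y;
  piso_const : forall (c : const_symbol L) x y, restr_closure graph x y ->
    sec_eq x (const_interp M c) = sec_eq y (const_interp N c);
  piso_fun : forall (f : fun_symbol L)
      (x : 'I_(fun_arity f) -> M) (y : 'I_(fun_arity f) -> N) x' y',
    (forall i, restr_closure graph (x i) (y i)) ->
    restr_closure graph x' y' ->
    sec_eq (fun_interp M f x) x' = sec_eq (fun_interp N f y) y'
}.

Definition piso_ext d (Omega : completeHeytingType d) (L : signature Omega)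
    (M N : structure L) (h : partial_iso M N) : M -> N -> Prop :=
  restr_closure (graph h).

(* The inclusion of h_q, the restriction of h to sections of extent exactly q,
   in h'. *)
Definition included_at d (Omega : completeHeytingType d) (L : signature Omega)
    (M N : structure L) (q : Omega) (h h' : partial_iso M N) : Prop :=
  forall x y, piso_ext h x y -> extent x = q -> piso_ext h' x y.

Record wellOrder := WellOrder {
  wo_sort :> Type;
  wo_le : rel wo_sort;
  wo_leP : wochoice.well_order wo_le
}.

Definition wo_lt (W : wellOrder) (x y : W) : Prop := ~~ wo_le y x.

Definition wo_below (W : wellOrder) (x : W) : Type := {y : W | wo_lt y x}.

Definition is_zero (W : wellOrder) (w : W) : Prop := forall v, ~ wo_lt v w.

Definition is_succ (W : wellOrder) (v w : W) : Prop :=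
  wo_lt v w /\ forall u, wo_lt u w -> wo_le u v.

Definition is_limit (W : wellOrder) (w : W) : Prop :=
  ~ is_zero w /\ forall v, ~ is_succ v w.

(* The point w of a well-ordered type stands for the order type of the set of
   points below w. *)
Record ordinal_number := OrdinalNumber {
  ord_order : wellOrder;
  ord_point : ord_order
}.

(* Initial ordinals.  The ordinals below the cardinal mu are the points of mu,
   and such a point gamma is identified with the type [wo_below gamma]. *)
Definition is_cardinal (mu : wellOrder) : Prop :=
  forall (gamma : mu) (f : mu -> wo_below gamma), ~ bijective f.

Section BackAndForth.
Context d (Omega : completeHeytingType d) (L : signature Omega).
Context (mu : wellOrder) (M N : structure L).

Definition forth (Q : Omega -> partial_iso M N -> Prop)
    (p : Omega) (h : partial_iso M N) : Prop :=
  forall (gamma : mu) (c : wo_below gamma -> M),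
    inhabited (wo_below gamma) -> tuple_below p c ->
    exists S : set (partial_iso M N * Omega * (wo_below gamma -> N)),
      (forall h' q e, S (h', q, e) ->
        [/\ Q q h', included_at q h h', tuple_below (tuple_extent c) e,
            tuple_extent e = q &
            forall i, piso_ext h' (restr (c i) q) (e i)]) /\
      csup [set t.1.2 | t in S] = tuple_extent c.

Definition back (Q : Omega -> partial_iso M N -> Prop)
    (p : Omega) (h : partial_iso M N) : Prop :=
  forall (gamma : mu) (e : wo_below gamma -> N),
    inhabited (wo_below gamma) -> tuple_below p e ->
    exists S : set (partial_iso M N * Omega * (wo_below gamma -> M)),
      (forall h' q c, S (h', q, c) ->
        [/\ Q q h', included_at q h h', tuple_below (tuple_extent e) c,
            tuple_extent c = q &
            forall i, piso_ext h' (c i) (restr (e i) q)]) /\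
      csup [set t.1.2 | t in S] = tuple_extent e.

Inductive Q (W : wellOrder) : W -> Omega -> partial_iso M N -> Prop :=
| Q_zero w p h : is_zero w -> Q w p h
| Q_succ v w p h : is_succ v w ->
    Q v p h -> forth (Q v) p h -> back (Q v) p h -> Q w p h
| Q_limit w p h : is_limit w ->
    (forall v, wo_lt v w -> Q v p h) -> Q w p h.

(* (M, a) ~^p_alpha (N, b), which is only meaningful for tuples a and b below
   p.  When p is the extent of a, this forces all entries of a to have
   extent p. *)
Definition sim (n : nat) (p : Omega) (alpha : ordinal_number)
    (a : 'I_n -> M) (b : 'I_n -> N) : Prop :=
  [/\ tuple_below p a, tuple_below p b &
      exists h : partial_iso M N,
        (forall x y, graph h x y <-> exists i, x = a i /\ y = b i) /\
        Q (ord_point alpha) p h].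

End BackAndForth.

(* Main.v *)
Require Import Defs.
From mathcomp Require Import all_boot all_order.
From mathcomp Require Import boolp classical_sets.
From mathcomp Require wochoice.

(** For each well order [W] the sets [Q w] decrease along [W], and [v < w]
    gives [Q w] included in the set of pairs satisfying Forth and Back relative
    to [Q v].  If at every [w] some pair of [Q w] violated Forth or Back relative
    to [Q w], these witnesses would be pairwise distinct, which is impossible
    when [W] well-orders the power set of the set of pairs [(p, h)].  So some
    [Q alpha] satisfies Forth and Back relative to itself, and any such set is
    contained in every [Q beta] by induction on [beta]. *)

(** Cantor's diagonal argument, applied to the set of values [g A] that lie outside [A]. *)
Lemma set_not_injective (T : Type) (g : set T -> T) : ~ injective g.
Proof.
move=> ginj; pose D : set T := fun x => exists2 A, g A = x & ~ A x.
have nD : ~ D (g D) by move=> /[dup] Dg [A /ginj ->].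
by apply: (nD); exists D.
Qed.

Lemma wo_le_anti (W : wellOrder) : antisymmetric (@wo_le W).
Proof.
have chainW : @wochoice.wo_chain {classic W} (@wo_le W) predT.
  by move=> A _; apply: wo_leP.
by move=> x y; apply: (wochoice.wo_chain_antisymmetric chainW).
Qed.

Lemma wo_neq_lt {W : wellOrder} {x y : W} : x <> y -> wo_lt x y \/ wo_lt y x.
Proof.
move=> xy; apply/orP; rewrite -negb_and.
by apply/negP; rewrite andbC => /wo_le_anti.
Qed.

Lemma wo_lt_ind (W : wellOrder) (P : W -> Prop) :
  (forall w, (forall v, wo_lt v w -> P v) -> P w) -> forall w, P w.
Proof.
move=> step w; apply: contrapT => nPw.
have [|z [[/asboolP nPz minz] _]] := @wo_leP W (fun v : W => `[< ~ P v >]).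
  by exists w; apply/asboolP.
apply: nPz; apply: step => v /negP vz.
by apply: contrapT => nPv; apply: vz; apply: minz; apply/asboolP.
Qed.

Section Stabilization.
Context {d : Order.disp_t} {Omega : completeHeytingType d}.
Context {L : signature Omega} {mu : wellOrder} {M N : structure L}.
Implicit Types (X Y : Omega -> partial_iso M N -> Prop).

Definition back_and_forth X p h := forth mu X p h /\ back mu X p h.

Lemma back_and_forth_mono {X Y p h} : (forall q k, X q k -> Y q k) ->
  back_and_forth X p h -> back_and_forth Y p h.
Proof.
move=> XY [F B]; split=> gamma c ne cp.
- have [S [SP Seq]] := F gamma c ne cp.
  by exists S; split=> // h' q e /SP[/XY ? ? ? ? ?].
- have [S [SP Seq]] := B gamma c ne cp.
  by exists S; split=> // h' q e /SP[/XY ? ? ? ? ?].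
Qed.

Lemma Q_lt_back_and_forth {W : wellOrder} {v w : W} {p h} :
  wo_lt v w -> Q mu w p h -> back_and_forth (Q mu v) p h.
Proof.
move=> + Qw; elim: Qw v => {w p h}
  [w p h w0 v /w0[] //|u w p h [uw umax] _ IH F B v vw|w p h [_ wlim] _ IH v vw].
- have [->|vu] := EM (v = u); first by [].
  have [|] := wo_neq_lt vu; first exact: IH.
  by move/negP; case; apply: umax.
(* Since the limit [w] does not succeed [v], some [u] lies strictly between them. *)
- have /not_andP[//|/existsNP[u /not_implyP[uw /negP vu]]] := wlim v.
  exact: (IH u).
Qed.

(** Coinduction: Forth and Back are monotone in the family, so at a successor of [v] the inclusion
    of [X] in [Q mu v] turns the closure of [X] into Forth and Back relative to [Q mu v]. *)
Lemma back_and_forth_subset_Q {X} :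
    (forall p h, X p h -> back_and_forth X p h) ->
  forall (W : wellOrder) (w : W) p h, X p h -> Q mu w p h.
Proof.
move=> Xfix W; elim/wo_lt_ind => w IH p h Xph.
have [|wN0] := EM (is_zero w); first exact: Q_zero.
have [[v vw]|wNsucc] := EM (exists v, is_succ v w).
- have vltw := vw.1.
  have [F B] := back_and_forth_mono (IH v vltw) (Xfix _ _ Xph).
  by apply: (Q_succ vw) => //; exact: IH.
- apply: Q_limit => [|v vw]; last exact: IH.
  by split=> // v vw; apply: wNsucc; exists v.
Qed.

Lemma Q_stabilizes : exists (W : wellOrder) (w : W),
  forall p h, Q mu w p h -> back_and_forth (Q mu w) p h.
Proof.
pose P := (Omega * partial_iso M N)%type.
have [R Rwo] := wochoice.well_ordering_principle {classic set P}.
pose W := WellOrder Rwo; exists W; apply: contrapT => /forallNP noW.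
have witness (w : W) :
    exists x : P, Q mu w x.1 x.2 /\ ~ back_and_forth (Q mu w) x.1 x.2.
  have /existsNP[p /existsNP[h /not_implyP[Qph Nph]]] := noW w.
  by exists (p, h).
have [g gP] := choice witness.
apply: (@set_not_injective P g) => v w gvw; apply: contrapT => vw.
have [Qv Nv] := gP v; have [Qw Nw] := gP w.
have [lt|lt] := @wo_neq_lt W v w vw.
- by apply: Nv; apply: Q_lt_back_and_forth lt _; rewrite gvw.
- by apply: Nw; apply: Q_lt_back_and_forth lt _; rewrite -gvw.
Qed.

End Stabilization.

Theorem proposition5p11 (d : Order.disp_t) (Omega : completeHeytingType d)
    (mu : wellOrder) (hmu : is_cardinal mu)
    (L : signature Omega) (M : structure L) :
  exists alpha : ordinal_number,
    forall (n : nat) (a b : 'I_n -> M),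
      tuple_extent a = tuple_extent b ->
      sim mu (tuple_extent a) alpha a b ->
      forall beta : ordinal_number, sim mu (tuple_extent a) beta a b.
Proof.
have [W [w stab]] := Q_stabilizes (mu := mu) (M := M) (N := M).
exists (OrdinalNumber w) => n a b _ [a_below b_below [h [graph_h Qh]]] beta.
split=> //; exists h; split=> //.
(* With [X] the stable stage, [beta] may live on a well order unrelated to [W]. *)
exact: back_and_forth_subset_Q stab _ _ _ _ Qh.
Qed.
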